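(* Let $\mathcal{G}=(G,\lambda)$ be a temporal graph. The following assertions are equivalent: (i) $\mathcal{G}$ admits a TTO (temporal transitive orientation); (ii) $\mathcal{G}$ admits an ATTO (almost temporal transitive orientation); (iii) $\mathrm{Ness}(\mathcal{G})$, the set of necessary arcs of $\mathcal{G}$, induces an acyclic digraph (i.e. the digraph on the vertex set of $G$ with arc set $\mathrm{Ness}(\mathcal{G})$ has no directed cycle, directed 2-cycles included).
   Context: A (simple) temporal graph $\mathcal{G}=(G,\lambda)$ consists of a finite simple undirected graph $G=(V,E)$ and a function $\lambda:E\to\mathbb{N}$ (time-labels). Let $AP(G)=\{(u,v): uv\in E\}$ be the set of all possible arcs, both directions of each edge. For $O\subseteq AP(G)$ let $O^R=\{(v,u):(u,v)\in O\}$. A partial orientation is a set $O\subseteq AP(G)$ with $O\cap O^R=\emptyset$; an orientation is a partial orientation with $O\cup O^R=AP(G)$. An orientation $O$ of $\mathcal{G}$ is a temporal transitive orientation (TTO) if whenever $(a,b)\in O$ and $(b,c)\in O$ with $\lambda(ab)\le\lambda(bc)$, then $(a,c)\in O$ and $\lambda(ac)\ge\lambda(bc)$. The implication digraph $\mathrm{Imp}(\mathcal{G})$ has vertex set $AP(G)$ and, for all distinct vertices $a,b,c$ with $ab,bc\in E$, $\lambda(ab)\le\lambda(bc)$ and ($ac\notin E$ or $\lambda(ac)<\lambda(bc)$), an arc from $(a,b)$ to $(c,b)$ and an arc from $(b,c)$ to $(b,a)$. A quadruple of distinct vertices $(a,b,c,d)$ forms a correlated monolabel triangle if there is $t\in\mathbb{N}$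 such that $ab,bc,ac\in E$ with $\lambda(ab)=\lambda(bc)=\lambda(ac)=t$; $bd\in E$ with $\lambda(bd)\le t$; $cd\in E$ with $\lambda(cd)>t$; and if $ad\in E$ then $\lambda(ad)<t$. The augmented implication digraph $\mathrm{Aug}(\mathcal{G})$ is obtained from $\mathrm{Imp}(\mathcal{G})$ by adding, for every correlated monolabel triangle $(a,b,c,d)$, the arcs $((b,c),(a,c))$ and $((c,a),(c,b))$. An arc $(x,y)\in AP(G)$ forces $(u,v)\in AP(G)$ if there is a directed path (possibly of length $0$) from $(x,y)$ to $(u,v)$ in $\mathrm{Aug}(\mathcal{G})$. For $O\subseteq AP(G)$, $O^+$ is the set of elements of $AP(G)$ forced by some arc of $O$. An orientation $O$ of $\mathcal{G}$ is an ATTO if $O^+=O$. An arc $(x,y)\in AP(G)$ is necessary if $(y,x)$ forces $(x,y)$; $\mathrm{Ness}(\mathcal{G})$ is the set of necessary arcs. *)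

(* Defs.v *)
From mathcomp Require Import all_boot.

Set Implicit Arguments.
Unset Strict Implicit.
Unset Printing Implicit Defensive.

(* [label] is total on pairs for convenience; it carries meaning only on edges,
   and every use below is guarded by adjacency of its two arguments. *)
Record temporal_graph (V : finType) := TemporalGraph {
  adj : rel V;
  label : V -> V -> nat;
  adj_sym : symmetric adj;
  adj_irr : irreflexive adj;
  label_sym : forall u v, adj u v -> label u v = label v u
}.

Section TemporalGraph.

Variables (V : finType) (G : temporal_graph V).
Local Notation E := (adj G).
Local Notation lam := (label G).

Implicit Types (O : {set V * V}) (p q : V * V) (a b c d : V).

Definition AP : {set V * V} := [set p | E p.1 p.2].

Definition arc_rev O : {set V * V} := [set p | (p.2, p.1) \in O].

Definition partial_orientation O : Prop :=
  O \subset AP /\ O :&: arc_rev O = set0.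

Definition orientation O : Prop :=
  partial_orientation O /\ O :|: arc_rev O = AP.

Definition TTO O : Prop :=
  orientation O /\
  forall a b c, (a, b) \in O -> (b, c) \in O -> lam a b <= lam b c ->
    (a, c) \in O /\ lam b c <= lam a c.

Definition imp_triple a b c : bool :=
  [&& uniq [:: a; b; c], E a b, E b c, lam a b <= lam b c
    & ~~ E a c || (lam a c < lam b c)].

Definition imp_arc : rel (V * V) := fun p q =>
  [exists a, exists b, exists c, imp_triple a b c &&
    ((p == (a, b)) && (q == (c, b)) || (p == (b, c)) && (q == (b, a)))].

(* The common label t of the triangle is [lam a b]. *)
Definition correlated_monolabel_triangle a b c d : bool :=
  let t := lam a b in
  [&& uniq [:: a; b; c; d],
      [&& E a b, E b c & E a c],
      (lam b c == t) && (lam a c == t),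
      E b d && (lam b d <= t),
      E c d && (t < lam c d)
    & E a d ==> (lam a d < t)].

Definition aug_arc : rel (V * V) := fun p q =>
  imp_arc p q ||
  [exists a, exists b, exists c, exists d,
    correlated_monolabel_triangle a b c d &&
    ((p == (b, c)) && (q == (a, c)) || (p == (c, a)) && (q == (c, b)))].

(* Both ends of every [aug_arc] lie in [AP], so requiring the endpoints to be
   in [AP] makes [connect] over [V * V] the reachability of the digraph whose
   vertex set is [AP]. *)
Definition forces : rel (V * V) := fun p q =>
  [&& p \in AP, q \in AP & connect aug_arc p q].

Definition forced_closure O : {set V * V} :=
  [set q | [exists p in O, forces p q]].

Definition ATTO O : Prop := orientation O /\ forced_closure O = O.

Definition Ness : {set V * V} := [set p | forces (p.2, p.1) p].

End TemporalGraph.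

Definition acyclic_digraph (V : finType) (A : {set V * V}) : Prop :=
  forall s : seq V, s != [::] -> ~ ucycle [rel u v | (u, v) \in A] s.

(* Main.v *)
Require Import Defs.
From mathcomp Require Import all_boot zify.

(* The heart is the passage from an ATTO to a TTO.  An ATTO fails to be a TTO
   only because of cyclically oriented monolabel triangles.  If a -> b -> c -> a
   is such a triangle in an ATTO O, then every arc (x, y) of O with an arc to
   (b, c) in Aug again lies on a cyclic monolabel triangle a -> x -> y -> a.
   Hence, for fixed a, all arcs opposite to a in such triangles can be reversed
   at once: the result is still an ATTO, a is on no cyclic triangle any more, and
   vertices that were on none remain so.  Doing this for every vertex in turn
   yields a TTO.
   A TTO is acyclic, since a cycle can be shortcut at the tail of an arc of
   maximal label, and it contains Ness; conversely, if Ness has no directed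
   2-cycle, an ATTO is a solution of a satisfiable 2-SAT instance. *)

Set Implicit Arguments.
Unset Strict Implicit.
Unset Printing Implicit Defensive.

(* Orientation hypotheses would only add boolean case splits to [lia]. *)
Ltac weight_lia :=
  repeat match goal with H : is_true (_ \in _) |- _ => clear H end; lia.

(** * Edge weights and the arcs of Aug *)

Section AugmentedImplications.

Variables (V : finType) (G : temporal_graph V).
Local Notation E := (adj G).
Implicit Types (O : {set V * V}) (p q : V * V) (a b c d u v x y : V).

(* Shifting labels by one lets [0] stand for a non-edge, so that "not an edge,
   or an edge of smaller label" becomes a single strict inequality. *)
Definition weight u v := if E u v then (label G u v).+1 else 0.
Local Notation w := weight.

Lemma weightC u v : w u v = w v u.
Proof. by rewrite /w (adj_sym G v u); case: ifP => // /label_sym ->. Qed.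

Lemma weight_gt0 u v : (0 < w u v) = E u v.
Proof. by rewrite /w; case: ifP. Qed.

Lemma weightvv v : w v v = 0.
Proof. by rewrite /w adj_irr. Qed.

Lemma weight_neq u v : 0 < w u v -> u != v.
Proof. by apply: contraTneq => ->; rewrite weightvv. Qed.

(** Positivity and the strict inequalities between weights encode adjacency and most distinctness
    conditions, because [w v v = 0]. Only [a != c] must be stated in the implication cases: for
    [a = c] the inequalities may well hold. *)
Variant aug_spec : V * V -> V * V -> Prop :=
  | AugIn a b c of a != c & 0 < w a b & w a b <= w b c & w a c < w b c :
      aug_spec (a, b) (c, b)
  | AugOut a b c of a != c & 0 < w a b & w a b <= w b c & w a c < w b c :
      aug_spec (b, c) (b, a)
  | AugCorIn a b c d of w a b = w b c & w a c = w b c & 0 < w b d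
      & w b d <= w b c & w b c < w c d & w a d < w b c :
      aug_spec (b, c) (a, c)
  | AugCorOut a b c d of w a b = w b c & w a c = w b c & 0 < w b d
      & w b d <= w b c & w b c < w c d & w a d < w b c :
      aug_spec (c, a) (c, b).

Lemma imp_tripleE a b c :
  imp_triple G a b c =
  [&& a != c, 0 < w a b, w a b <= w b c & w a c < w b c].
Proof.
rewrite /imp_triple /= !inE negb_or andbT !weight_gt0 /w.
case: (eqVneq a b) => [->|_]; first by rewrite adj_irr /= andbF.
case: (eqVneq b c) => [->|_]; first by rewrite adj_irr /= !andbF.
by case: (E a b); case: (E b c); case: (E a c); rewrite //= ?andbF ?andbT.
Qed.

Lemma correlated_monolabel_triangleE a b c d :
  correlated_monolabel_triangle G a b c d =
  [&& w a b == w b c, w a c == w b c, 0 < w b d, w b d <= w b c,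
      w b c < w c d & w a d < w b c].
Proof.
apply/idP/idP.
  case/and5P=> _ /and3P[Eab Ebc Eac] /andP[bct act] /andP[Ebd bdt].
  case/andP=> /andP[Ecd tcd]; rewrite /w Eab Ebc Eac Ebd Ecd.
  by case: (E a d); rewrite /=; lia.
case/and5P=> /eqP ab /eqP ac bd bdt /andP[cd ad].
have [Eab Ebc Eac] : [/\ E a b, E b c & E a c].
  by rewrite -!weight_gt0 ab ac; split; lia.
have [Ebd Ecd] : E b d /\ E c d by rewrite -!weight_gt0; split; lia.
have := weightC a c; have := weightC b c; have := weightC a b.
have := weightC b d; have := weightC c d => cdC bdC abC bcC acC.
have [n1 n2 n3] : [/\ a != b, a != c & b != c].
  by split; apply: weight_neq; rewrite weight_gt0.
(* The vertices [a] and [d] may be non-adjacent; but [a = d] would make [w c d] equal to [w a c],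
   against [w b c < w c d]. *)
have n4 : a != d by apply/eqP=> eq_ad; move: cd; rewrite -eq_ad; lia.
have [n5 n6] : b != d /\ c != d.
  by split; apply: weight_neq; rewrite weight_gt0.
rewrite /correlated_monolabel_triangle /= !inE !negb_or n1 n2 n3 n4 n5 n6 /=.
rewrite Eab Ebc Eac Ebd Ecd /=.
move: ab ac bdt cd ad; rewrite /w Eab Ebc Eac Ebd Ecd => -[->] [->].
by rewrite eqxx !ltnS => -> ->; case: (E a d).
Qed.

Lemma aug_arcP p q : reflect (aug_spec p q) (aug_arc G p q).
Proof.
apply: (iffP orP).
  case.
    case/existsP=> a /existsP[b] /existsP[c]; rewrite imp_tripleE.
    case/andP=> /and4P[n1 n2 n3 n4] /orP[] /andP[/eqP-> /eqP->].
      exact: AugIn.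
    exact: AugOut.
  case/existsP=> a /existsP[b] /existsP[c] /existsP[d].
  rewrite correlated_monolabel_triangleE.
  case/andP=> /and5P[/eqP n1 /eqP n2 n3 n4 /andP[n5 n6]].
  case/orP => /andP[/eqP-> /eqP->].
    exact: AugCorIn n6.
  exact: AugCorOut n6.
case=> a b c.
- move=> n1 n2 n3 n4; left.
  apply/existsP; exists a; apply/existsP; exists b; apply/existsP; exists c.
  by rewrite imp_tripleE n1 n2 n3 n4 !eqxx.
- move=> n1 n2 n3 n4; left.
  apply/existsP; exists a; apply/existsP; exists b; apply/existsP; exists c.
  by rewrite imp_tripleE n1 n2 n3 n4 !eqxx orbT.
- move=> d n1 n2 n3 n4 n5 n6; right.
  apply/existsP; exists a; apply/existsP; exists b; apply/existsP; exists c.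
  apply/existsP; exists d; rewrite correlated_monolabel_triangleE.
  by rewrite n1 n2 n3 n4 n5 n6 !eqxx.
- move=> d n1 n2 n3 n4 n5 n6; right.
  apply/existsP; exists a; apply/existsP; exists b; apply/existsP; exists c.
  apply/existsP; exists d; rewrite correlated_monolabel_triangleE.
  by rewrite n1 n2 n3 n4 n5 n6 !eqxx orbT.
Qed.

(** * Skew symmetry of Aug and of forcing *)

Definition arc_swap p : V * V := (p.2, p.1).

Lemma arc_swapK : involutive arc_swap.
Proof. by case. Qed.

(** The two arcs contributed by one triple, or by one correlated triangle, are contrapositives of
    each other, as in the implication digraph of a 2-SAT formula. *)
Lemma aug_arc_swap p q : aug_arc G (arc_swap q) (arc_swap p) = aug_arc G p q.
Proof.
have aug p' q' : aug_arc G p' q' -> aug_arc G (arc_swap q') (arc_swap p').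
  case/aug_arcP=> a b c => [n1 n2 n3 n4|n1 n2 n3 n4|d *|d *]; apply/aug_arcP.
  - exact: AugOut.
  - exact: AugIn.
  - exact: (@AugCorOut a b c d).
  - exact: (@AugCorIn a b c d).
by apply/idP/idP=> /aug //; rewrite !arc_swapK.
Qed.

Lemma connect_aug_arc_swap p q :
  connect (aug_arc G) p q -> connect (aug_arc G) (arc_swap q) (arc_swap p).
Proof.
case/connectP=> s; elim: s p => [|r s IHs] p /=; first by move=> _ ->.
case/andP=> pr rs qE; apply: connect_trans (IHs _ rs qE) (connect1 _).
by rewrite aug_arc_swap.
Qed.

Lemma AP_swap p : (arc_swap p \in AP G) = (p \in AP G).
Proof. by rewrite !inE adj_sym. Qed.

Lemma forces_swap p q : forces G (arc_swap q) (arc_swap p) = forces G p q.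
Proof.
have forc p' q' : forces G p' q' -> forces G (arc_swap q') (arc_swap p').
  case/and3P=> Ep Eq /connect_aug_arc_swap pq.
  by rewrite /forces !AP_swap Ep Eq.
by apply/idP/idP=> /forc //; rewrite !arc_swapK.
Qed.

Lemma forces_trans : transitive (forces G).
Proof.
move=> q p r /and3P[Ep _ pq] /and3P[_ Er qr]; rewrite /forces Ep Er /=.
exact: connect_trans qr.
Qed.

Lemma aug_arc_AP p q : aug_arc G p q -> (p \in AP G) && (q \in AP G).
Proof.
case/aug_arcP=> a b c => [_|_|d|d]; rewrite !inE /= -!weight_gt0;
  rewrite ?(weightC c b) ?(weightC b a) ?(weightC c a) => *; lia.
Qed.

Lemma aug_arc_share p q : aug_arc G p q -> p.1 = q.1 \/ p.2 = q.2.
Proof. by case/aug_arcP; [right|left|right|left]. Qed.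

(** * Orientations, ATTOs and TTOs described arc by arc *)

Lemma orientationP O :
  orientation G O <->
  (forall a b, (a, b) \in O -> E a b) /\
  (forall a b, E a b -> ((a, b) \in O) = ((b, a) \notin O)).
Proof.
split.
  case=> -[/subsetP sOA /setP O0] /setP OT; split=> a b.
    by move/sOA; rewrite inE.
  move=> Eab; have := OT (a, b); have := O0 (a, b); rewrite !inE /= Eab.
  by case: (_ \in O); case: (_ \in O).
case=> OE Odec; split; [split|].
- by apply/subsetP=> -[a b] /OE; rewrite inE.
- apply/setP=> -[a b]; rewrite !inE /=; apply/negbTE/negP=> /andP[Oab Oba].
  by have := Odec _ _ (OE _ _ Oab); rewrite Oab Oba.
- apply/setP=> -[a b]; rewrite !inE /=; apply/orP/idP => [[/OE//|/OE]|].
    by rewrite adj_sym.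
  by move/Odec->; case: (_ \in O); [right|left].
Qed.

Lemma ATTO_P O :
  ATTO G O <->
  orientation G O /\ (forall p q, aug_arc G p q -> p \in O -> q \in O).
Proof.
split=> -[orO clO]; split=> //.
  move=> p q pq Op; rewrite -clO inE; apply/existsP; exists p; rewrite Op.
  by case/andP: (aug_arc_AP pq) => Ep Eq; rewrite /forces Ep Eq connect1.
have [OE _] := (orientationP O).1 orO.
apply/setP=> q; rewrite inE; apply/existsP/idP => [[p /andP[Op]]|Oq].
  case/and3P=> _ _ /connectP[s]; elim: s p Op => [|r s IHs] p Op /=.
    by move=> _ ->.
  by case/andP=> pr; apply: IHs; apply: clO pr Op.
exists q; rewrite Oq /forces connect0 andbT.
by case: q Oq => a b /OE; rewrite inE => ->.
Qed.

(* Since the three weights agree and one of the edges is oriented, the triangle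
   is monolabel. *)
Definition cyclic_triangle O a b c :=
  [&& (a, b) \in O, (b, c) \in O, (c, a) \in O, w a b == w b c
    & w b c == w c a].

Lemma cyclic_triangle_rot O a b c :
  cyclic_triangle O a b c = cyclic_triangle O b c a.
Proof.
apply/and5P/and5P=> -[-> -> -> /eqP e1 /eqP e2]; split=> //; apply/eqP; lia.
Qed.

Lemma TTO_weightP O :
  TTO G O <->
  orientation G O /\
  forall a b c, (a, b) \in O -> (b, c) \in O -> w a b <= w b c ->
    (a, c) \in O /\ w b c <= w a c.
Proof.
split=> -[orO trO]; split=> // a b c Oab Obc abc;
  have [OE _] := (orientationP O).1 orO; have [Eab Ebc] := (OE _ _ Oab, OE _ _ Obc).
  have [|Oac ?] := trO a b c Oab Obc; first by move: abc; rewrite /w Eab Ebc.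
  by rewrite /w Ebc (OE _ _ Oac).
have [|Oac] := trO a b c Oab Obc; first by rewrite /w Eab Ebc.
by rewrite /w Ebc (OE _ _ Oac).
Qed.

(** * Cyclic monolabel triangles in an ATTO *)

Section ClosedOrientation.

Variable O : {set V * V}.
Hypothesis attoO : ATTO G O.
Local Notation "x ~> y" := ((x, y) \in O) (at level 70).

Lemma ATTO_weight a b : a ~> b -> 0 < w a b.
Proof.
by have [/orientationP[OE _] _] := attoO; rewrite weight_gt0; apply: OE.
Qed.

Lemma ATTO_asym a b : a ~> b -> b ~> a -> False.
Proof.
have [/orientationP[OE Odec] _] := attoO => Oab Oba.
by have := Odec _ _ (OE _ _ Oab); rewrite Oab Oba.
Qed.

Lemma ATTO_total a b : 0 < w a b -> a ~> b \/ b ~> a.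
Proof.
have [/orientationP[_ Odec] _] := attoO; rewrite weight_gt0 => /Odec->.
by case: (b ~> a); [right|left].
Qed.

(** When [a = c] the conclusion is the first hypothesis, here and in [ATTO_out]; uses of both rules
    thus leave only weight comparisons to check. *)
Lemma ATTO_in a b c : a ~> b -> w a b <= w b c -> w a c < w b c -> c ~> b.
Proof.
move=> ab abc ac; have [<- //|n_ac] := eqVneq a c.
have [_ clO] := (ATTO_P O).1 attoO.
apply: clO (ab); apply/aug_arcP; apply: AugIn => //.
exact: ATTO_weight ab.
Qed.

Lemma ATTO_out a b c :
  b ~> c -> 0 < w a b -> w a b <= w b c -> w a c < w b c -> b ~> a.
Proof.
move=> bc ab abc ac; have [-> //|n_ac] := eqVneq a c.
have [_ clO] := (ATTO_P O).1 attoO.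
by apply: clO bc; apply/aug_arcP; apply: AugOut.
Qed.

Lemma ATTO_cor a b c d :
    b ~> c -> w a b = w b c -> w a c = w b c -> 0 < w b d ->
    w b d <= w b c -> w b c < w c d -> w a d < w b c ->
  a ~> c.
Proof.
move=> bc *; have [_ clO] := (ATTO_P O).1 attoO.
by apply: clO bc; apply/aug_arcP; apply: (@AugCorIn a b c d).
Qed.

(* The analogue of Golumbic's triangle lemma. *)
Lemma cyclic_triangle_pred a b c p :
    cyclic_triangle O a b c -> p \in O -> aug_arc G p (b, c) ->
  cyclic_triangle O a p.1 p.2.
Proof.
case/and5P=> ab bc ca /eqP eq1 /eqP eq2 Op /aug_arcP.
move Dq: (b, c) => q augpq.
have gt1 := ATTO_weight ab.
have := weightC a b; have := weightC b c; have := weightC a c => acC bcC abC.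
(* The predecessor is [(d, c)] in the first and third cases and [(b, d)] in the other two; [f] is
   the fourth vertex of a correlated triangle. Comparing the weights of [ad] and [af] with the
   others leads either to two opposite arcs in [O] or to the required triangle. *)
case: augpq Dq Op => [d c' b'|c' b' d|b' d c' f|d c' b' f].
- move=> _ d0 dcb dba [? ?]; subst b' c' => dc.
  have := weightC a d; have := weightC b d; have := weightC c d => cdC bdC adC.
  have [lt_da|gt_da|eq_da] := ltngtP (w a d) (w a b).
  + have ac : a ~> c by apply: (ATTO_in dc); weight_lia.
    by case: (ATTO_asym ac ca).
  + have ba : b ~> a by apply: (@ATTO_cor b c a d); first [exact: ca | weight_lia].
    by case: (ATTO_asym ab ba).
  + have ad : a ~> d by apply: (ATTO_out ab); weight_lia.
    have [lt_dc|//|eq_dc] := ltngtP (w d c) (w c b); last 2 first.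
    * weight_lia.
    * by rewrite /cyclic_triangle ad dc ca /=; apply/andP; split; apply/eqP; weight_lia.
    have ac : a ~> c by apply: (ATTO_out ad); weight_lia.
    by case: (ATTO_asym ac ca).
- move=> _ cb0 cbd cd [? ?]; subst b' c' => bd.
  have := weightC a d; have := weightC b d; have := weightC c d => cdC bdC adC.
  have [le_bd_ad|lt_ad_bd] := leqP (w b d) (w a d); last first.
    have db : d ~> b by apply: (ATTO_in ab); weight_lia.
    by case: (ATTO_asym bd db).
  have da : d ~> a by apply: (ATTO_in ca); weight_lia.
  have [le_ad|gt_ad] := leqP (w a d) (w a b); last first.
    have db : d ~> b by apply: (ATTO_out da); weight_lia.
    by case: (ATTO_asym bd db).
  by rewrite /cyclic_triangle ab bd da /=; apply/andP; split; apply/eqP; weight_lia.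
- move=> eq3 eq4 df0 dfc cf bf [? ?]; subst b' c' => dc.
  have := weightC a d; have := weightC b d; have := weightC c d => cdC bdC adC.
  have := weightC a f; have := weightC b f => bfC afC.
  have := weightC c f; have := weightC d f => dfC cfC.
  (* The heavy edge [cf] must point to [c]; this fixes [df] and then [bd]. *)
  have fc : f ~> c by apply: (ATTO_in dc); weight_lia.
  have fd : f ~> d by apply: (ATTO_out fc); weight_lia.
  have bd : b ~> d by apply: (ATTO_in fd); weight_lia.
  have [lt_da|gt_da|eq_da] := ltngtP (w a d) (w a b).
  + have ac : a ~> c by apply: (ATTO_in dc); weight_lia.
    by case: (ATTO_asym ac ca).
  + have da : d ~> a by apply: (ATTO_in ca); weight_lia.
    have db : d ~> b by apply: (ATTO_out da); weight_lia.
    by case: (ATTO_asym bd db).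
  have [|ad|da] := @ATTO_total a d; first weight_lia.
    by rewrite /cyclic_triangle ad dc ca /=; apply/andP; split; apply/eqP; weight_lia.
  (* Here [ad] points the wrong way, and every possible weight of [af] has to be refuted. *)
  have [lt_fa|gt_fa|eq_fa] := ltngtP (w a f) (w a b).
  + have ad : a ~> d by apply: (ATTO_in fd); weight_lia.
    by case: (ATTO_asym ad da).
  + have ba : b ~> a by apply: (@ATTO_cor b d a f); first [exact: da | weight_lia].
    by case: (ATTO_asym ab ba).
  + have af : a ~> f by apply: (ATTO_out ab); weight_lia.
    have cf' : c ~> f by apply: (ATTO_in af); weight_lia.
    by case: (ATTO_asym fc cf').
- move=> eq3 eq4 cf0 cfb bf df [? ?]; subst b' c' => bd.
  have := weightC a d; have := weightC b d; have := weightC c d => cdC bdC adC.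
  have := weightC a f; have := weightC b f => bfC afC.
  have := weightC c f; have := weightC d f => dfC cfC.
  have [lt_da|gt_da|eq_da] := ltngtP (w a d) (w a b).
  + have db : d ~> b by apply: (ATTO_in ab); weight_lia.
    by case: (ATTO_asym bd db).
  + have da : d ~> a by apply: (ATTO_in ca); weight_lia.
    have db : d ~> b by apply: (ATTO_out da); weight_lia.
    by case: (ATTO_asym bd db).
  have [|ad|da] := @ATTO_total a d; first weight_lia; last first.
    by rewrite /cyclic_triangle ab bd da /=; apply/andP; split; apply/eqP; weight_lia.
  have [le_fa|gt_fa] := leqP (w a f) (w a b).
    have fb : f ~> b by apply: (ATTO_in ab); weight_lia.
    have fc : f ~> c by apply: (ATTO_out fb); weight_lia.
    have [lt_fa|eq_fa] : w a f < w a b \/ w a f = w a b by weight_lia.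
      have ac : a ~> c by apply: (ATTO_in fc); weight_lia.
      by case: (ATTO_asym ac ca).
    have fa : f ~> a by apply: (ATTO_out fb); weight_lia.
    have af : a ~> f by apply: (ATTO_out ad); weight_lia.
    by case: (ATTO_asym af fa).
  have fa : f ~> a by apply: (ATTO_in ca); weight_lia.
  have fc : f ~> c by apply: (ATTO_out fa); weight_lia.
  have dc : d ~> c by apply: (ATTO_in fc); weight_lia.
  have da : d ~> a by apply: (@ATTO_cor d c a f); first [exact: ca | weight_lia].
  by case: (ATTO_asym ad da).
Qed.

(** * Reversing the arcs opposite to a vertex *)

Definition flip v : {set V * V} :=
  let C := [set p | cyclic_triangle O v p.1 p.2] in (O :\: C) :|: arc_rev C.

Lemma in_flip v x y :
  ((x, y) \in flip v) =
  ((x, y) \in O) && ~~ cyclic_triangle O v x y || cyclic_triangle O v y x.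
Proof. by rewrite !inE andbC. Qed.

Lemma cyclic_triangle_asym a b c :
  cyclic_triangle O a b c -> ~~ cyclic_triangle O a c b.
Proof.
case/and5P=> _ bc _ _ _; apply/negP=> /and5P[_ cb _ _ _].
exact: ATTO_asym bc cb.
Qed.

(** By [cyclic_triangle_pred], the reversed arcs are closed under predecessors in [O], so an
    unreversed arc never leads to a reversed one. For arcs created by the reversal, the same
    argument is applied to the contrapositive arc of Aug. *)
Lemma flip_ATTO v : ATTO G (flip v).
Proof.
have [orO clO] := (ATTO_P O).1 attoO.
have [OE Odec] := (orientationP O).1 orO.
have cycO x y : cyclic_triangle O v x y -> (x, y) \in O by case/and5P.
apply/ATTO_P; split.
  apply/orientationP; split=> x y.
    by rewrite in_flip => /orP[/andP[/OE]|/cycO/OE]; rewrite // adj_sym.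
  move=> Exy; rewrite !in_flip (Odec x y Exy) negb_or negb_and negbK.
  have [/cyclic_triangle_asym->|_] := boolP (cyclic_triangle O v y x).
    by rewrite !orbT.
  by rewrite !orbF.
move=> [x y] [x' y'] aug.
have pred a b c d : aug_arc G (a, b) (c, d) -> (a, b) \in O ->
    cyclic_triangle O v c d -> cyclic_triangle O v a b.
  by move=> ab_cd Oab cyc; have := cyclic_triangle_pred cyc Oab ab_cd.
rewrite !in_flip; case/orP=> [/andP[Oxy ncyc]|cyc].
  rewrite (clO _ _ aug Oxy); apply/orP; left.
  by apply: contra ncyc; apply: pred.
have aug' : aug_arc G (y', x') (y, x) by rewrite -aug_arc_swap.
have [Oxy'|nOxy'] := boolP ((x', y') \in O); last first.
  apply/orP; right; apply: pred aug' _ cyc.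
  have := aug_arc_AP aug; rewrite !inE /= => /andP[_ E'].
  by move: nOxy'; rewrite (Odec _ _ E') negbK.
(* The two arcs share an end, and the triangles on [(v, y, x)] and [(v, x', y')] would orient the
   edge from it to [v] both ways. *)
apply/orP; left=> /=; apply/negP=> /and5P[vx' _ y'v _ _].
case/and5P: cyc => vy _ xv _ _; case: (aug_arc_share aug) => /= [eqx|eqy].
  by rewrite -eqx in vx'; apply: ATTO_asym vx' xv.
by rewrite -eqy in y'v; apply: ATTO_asym vy y'v.
Qed.

Definition cyclic_free O v := [forall x, forall y, ~~ cyclic_triangle O v x y].

(** No reversed arc is incident to [u], so in a cyclic triangle of [flip v] at [u] only the arc
    opposite to [u] can be new. If it is, it comes from a triangle at [v] on the same edge with the
    same label. *)
Lemma flip_cyclic_free v u :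
  cyclic_free O u \/ u = v -> cyclic_free (flip v) u.
Proof.
move=> free_u.
have nocyc x y : ~~ cyclic_triangle O v u x && ~~ cyclic_triangle O v y u.
  case: free_u => [/forallP free_u|->].
    rewrite cyclic_triangle_rot (forallP (free_u _)) /=.
    by rewrite -cyclic_triangle_rot (forallP (free_u _)).
  have vvO : ~ v ~> v by move=> vv; exact: (ATTO_asym vv vv).
  by apply/andP; split; apply/negP=> /and5P[].
have outO x : ((u, x) \in flip v) = ((u, x) \in O).
  have /andP[n1 n2] := nocyc x x.
  by rewrite in_flip n1 (negbTE n2) andbT orbF.
have inO y : ((y, u) \in flip v) = ((y, u) \in O).
  have /andP[n1 n2] := nocyc y y.
  by rewrite in_flip n2 (negbTE n1) andbT orbF.
apply/forallP=> x; apply/forallP=> y; apply/negP=> /and5P[].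
rewrite outO inO in_flip => ux xy yu /eqP eq1 /eqP eq2.
case/orP: xy => [/andP[xy nxy]|].
  have uxy : cyclic_triangle O u x y.
    by rewrite /cyclic_triangle ux xy yu eq1 eq2 !eqxx.
  case: free_u => [/forallP/(_ x)/forallP/(_ y)|eq_uv]; first by rewrite uxy.
  by rewrite -eq_uv uxy in nxy.
case/and5P=> vy yx xv /eqP eq3 /eqP eq4.
case: free_u => [free_u|eq_uv]; last first.
  by rewrite eq_uv in yu; apply: ATTO_asym vy yu.
have notcyc a b : ~~ cyclic_triangle O u a b.
  by move/forallP: free_u => /(_ a)/forallP.
have := weightC u v; have := weightC u x; have := weightC u y => yuC xuC vuC.
have := weightC v x; have := weightC v y; have := weightC x y => xyC vyC vxC.
have ux0 := ATTO_weight ux.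
(* Unequal weights contradict closure of [O]. If [uv] carries the common label, either direction of
   it completes a cyclic triangle of [O] at [u]. *)
have [lt_uv|gt_uv|eq_uv] := ltngtP (w u v) (w u x).
- have vx : v ~> x by apply: (ATTO_in ux); weight_lia.
  by case: (ATTO_asym vx xv).
- have uv : u ~> v by apply: (ATTO_in xv); weight_lia.
  have uy : u ~> y by apply: (ATTO_out uv); weight_lia.
  by case: (ATTO_asym uy yu).
have [|uv|vu] := @ATTO_total u v; first weight_lia.
- case/negP: (notcyc v y); rewrite /cyclic_triangle uv vy yu /=.
  by apply/andP; split; apply/eqP; weight_lia.
- case/negP: (notcyc x v); rewrite /cyclic_triangle ux xv vu /=.
  by apply/andP; split; apply/eqP; weight_lia.
Qed.

(** Closure under the implication arcs rules out every violation of the TTO condition except a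
    directed triangle with three equal weights. *)
Lemma cyclic_free_TTO : (forall v, cyclic_free O v) -> TTO G O.
Proof.
move=> freeO; apply/TTO_weightP; split; first by case: attoO.
move=> a b c ab bc le_ab_bc.
have := weightC a b; have := weightC b c; have := weightC a c => acC bcC abC.
have ab0 := ATTO_weight ab.
have [le_bc_ac|lt_ac_bc] := leqP (w b c) (w a c); last first.
  have cb : c ~> b by apply: (ATTO_in ab); weight_lia.
  by case: (ATTO_asym bc cb).
have [|//|ca] := @ATTO_total a c; first weight_lia.
have [eq_ab_ac|lt_ab_ac] : w a b = w a c \/ w a b < w a c by lia.
  have /forallP/(_ b)/forallP/(_ c) := freeO a.
  rewrite /cyclic_triangle ab bc ca /= => /negP[].
  by apply/andP; split; apply/eqP; weight_lia.
have ac : a ~> c by apply: (ATTO_in bc); weight_lia.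
by case: (ATTO_asym ac ca).
Qed.

End ClosedOrientation.

Lemma ATTO_TTO O : ATTO G O -> exists O', TTO G O'.
Proof.
move=> attoO.
have [O' attoO' freeO'] : exists2 O', ATTO G O' &
    forall v, v \in enum V -> cyclic_free O' v.
  elim: (enum V) => [|v s [O' attoO' freeO']]; first by exists O.
  exists (flip O' v) => [|u]; first exact: flip_ATTO.
  rewrite inE => /predU1P u_in; apply: flip_cyclic_free => //.
  by case: u_in => [|/freeO']; [right|left].
by exists O'; apply: cyclic_free_TTO => // v; rewrite freeO' // mem_enum.
Qed.

(** * TTOs: closure under forcing, necessary arcs, acyclicity *)

Lemma TTO_ATTO O : TTO G O -> ATTO G O.
Proof.
case/TTO_weightP=> orO trO; have [OE Odec] := (orientationP O).1 orO.
have orE a b : 0 < w a b -> (a, b) \notin O -> (b, a) \in O.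
  by rewrite weight_gt0 => /Odec->; rewrite negbK.
have arc_in a b c : (a, b) \in O -> w a b <= w b c -> w a c < w b c ->
    (c, b) \in O.
  move=> ab le_abc lt_ac; apply: orE; first lia.
  by apply/negP=> bc; have [_] := trO _ _ _ ab bc le_abc; lia.
have arc_out a b c : 0 < w a b -> (b, c) \in O -> w a b <= w b c ->
    w a c < w b c -> (b, a) \in O.
  move=> ab0 bc le_abc lt_ac; apply: orE => //.
  by apply/negP=> ab; have [_] := trO _ _ _ ab bc le_abc; lia.
(* From [(b, c)] the heavy edge [cd] yields in turn [(d, c)], [(d, b)] and [(a, b)]; transitivity
   along [a], [b], [c] concludes. *)
have cor a b c d : w a b = w b c -> w a c = w b c -> 0 < w b d ->
    w b d <= w b c -> w b c < w c d -> w a d < w b c -> (b, c) \in O ->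
  (a, c) \in O.
  move=> eq1 eq2 bd0 bdc bcd ad bc.
  have := weightC b d; have := weightC c d; have := weightC a d => adC cdC bdC.
  have := weightC a b; have := weightC b c => bcC abC.
  have dc : (d, c) \in O by apply: (arc_in _ _ _ bc); weight_lia.
  have db : (d, b) \in O by apply: (arc_out _ _ _ _ dc); weight_lia.
  have ab : (a, b) \in O by apply: (arc_in _ _ _ db); weight_lia.
  by case: (trO _ _ _ ab bc); weight_lia.
apply/ATTO_P; split=> // p q /aug_arcP[] a b c.
- by move=> _ _ le_abc lt_ac ab; apply: arc_in ab le_abc lt_ac.
- by move=> _ ab0 le_abc lt_ac bc; apply: arc_out ab0 bc le_abc lt_ac.
- by move=> d *; apply: (cor a b c d).
move=> d eq1 eq2 bd0 bdc bcd ad ca; apply: orE; first lia.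
apply/negP=> bc; have ac := cor a b c d eq1 eq2 bd0 bdc bcd ad bc.
by have := Odec _ _ (OE _ _ ac); rewrite ac ca.
Qed.

Lemma ATTO_forces O p q : ATTO G O -> forces G p q -> p \in O -> q \in O.
Proof.
case=> _ <- pq; rewrite !inE => /existsP[r /andP[Or rp]].
by apply/existsP; exists r; rewrite Or (forces_trans rp pq).
Qed.

Lemma Ness_sub_ATTO O : ATTO G O -> Ness G \subset O.
Proof.
move=> attoO; apply/subsetP=> -[x y]; rewrite inE /= => yx_xy.
have [/orientationP[_ Odec] _] := attoO.
have Exy : E x y by case/and3P: yx_xy => _; rewrite inE.
by rewrite (Odec _ _ Exy); apply/negP=> Oyx;
  have := ATTO_forces attoO yx_xy Oyx; rewrite (Odec _ _ Exy) Oyx.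
Qed.

(* A last arc of maximal label can be shortcut backwards along the path,
   without losing maximality. *)
Lemma TTO_path O b c s : TTO G O ->
    path [rel x y | ((x, y) \in O) && (w x y <= w b c)] c s ->
  last c s = b -> (b, c) \notin O.
Proof.
case/TTO_weightP=> orO trO; have [OE Odec] := (orientationP O).1 orO.
elim/last_ind: s b => [|s y IHs] b /=.
  by move=> _ <-; apply/negP=> /OE; rewrite adj_irr.
rewrite rcons_path last_rcons => /andP[cs /= /andP[ab le_abc]] eq_yb.
rewrite {}eq_yb in ab le_abc *; apply/negP=> bc.
have [ac le_bc_ac] := trO _ _ _ ab bc le_abc.
suff /negP: (last c s, c) \notin O by apply.
apply: IHs => //.
apply: sub_path cs => x z /= /andP[-> le_xz] /=; exact: leq_trans le_bc_ac.
Qed.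

Lemma TTO_acyclic O : TTO G O -> acyclic_digraph O.
Proof.
move=> ttoO s; case def_s: s => [//|x0 s0] _.
rewrite -def_s => /andP[cyc_s uniq_s].
have x0s : x0 \in s by rewrite def_s mem_head.
(* An arc of maximal weight leaves [b]; after rotating the cycle to start at [b], the rest is a path
   from its successor back to [b], as [TTO_path] requires. *)
case: (@arg_maxnP _ x0 [in s] (fun x => w x (next s x)) x0s) => b bs maxb.
have [i t def_t] := rot_to bs.
have cyc_t : cycle [rel x y | ((x, y) \in O) && (w x y <= w b (next s b))] s.
  apply: cycle_from_next => // x xs /=.
  by have /= -> := next_cycle cyc_s xs; apply: maxb.
have eq_next : next s b = next (b :: t) b by rewrite -def_t next_rot.
have := next_cycle cyc_s bs; rewrite /= eq_next.
move: cyc_t; rewrite -(rot_cycle i) def_t eq_next.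
(* A cycle of length one would be a loop. *)
case: t {def_t eq_next} => [|c t] /=; rewrite eqxx.
  by case/TTO_weightP: ttoO => /orientationP[OE _] _ _ /OE; rewrite adj_irr.
case/andP=> _ cyc_t bc; apply/negP: bc; apply: TTO_path cyc_t _ => //.
by rewrite last_rcons.
Qed.

(** * Constructing an ATTO when Ness is acyclic *)

Lemma acyclic_Ness_swap p :
  acyclic_digraph (Ness G) -> p \in Ness G -> arc_swap p \notin Ness G.
Proof.
case: p => x y acyN xyN; apply/negP=> yxN.
have neq_xy : x != y.
  apply: weight_neq; rewrite weight_gt0.
  by move: xyN; rewrite inE => /and3P[_]; rewrite inE.
case: (acyN [:: x; y]) => //; rewrite /ucycle /= mem_seq1 neq_xy /=.
by rewrite xyN (yxN : (y, x) \in Ness G).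
Qed.

(** An inclusion-maximal set of arcs that is closed under forcing and contains no two opposite arcs
    must orient every edge. *)
Lemma acyclic_Ness_ATTO : acyclic_digraph (Ness G) -> exists O, ATTO G O.
Proof.
move=> acyN.
pose consistent O := [&& O \subset AP G, [forall p in O, arc_swap p \notin O]
  & [forall p in O, forall q, forces G p q ==> (q \in O)]].
have con0 : consistent set0.
  by rewrite /consistent sub0set /=; apply/andP; split;
    apply/forall_inP=> p; rewrite inE.
have [O /maxsetP[/and3P[sOA /forall_inP asymO /forall_inP clO] maxO] _] :=
  maxset_exists con0.
have {}clO p q : forces G p q -> p \in O -> q \in O.
  by move=> pq /clO/forallP/(_ q)/implyP; apply.
have OAP p : p \in O -> p \in AP G by apply: (subsetP sOA).
have extend p : p \in AP G -> arc_swap p \notin O ->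
    ~~ forces G p (arc_swap p) -> p \in O.
  move=> Ep nOp np; pose F := [set q | forces G p q].
  rewrite -(maxO (O :|: F)) ?subsetUl //.
    by rewrite in_setU [p \in F]inE /forces Ep connect0 orbT.
  apply/and3P; split.
  - rewrite subUset sOA; apply/subsetP=> q; rewrite inE.
    by case/and3P.
  (* Skew symmetry excludes both conflicts. If [O] contained the reverse of an arc forced by [p], it
     would contain the reverse of [p]; if [p] forced two opposite arcs, it would force its own
     reverse. *)
  - have disj q : forces G p q -> arc_swap q \notin O.
      move=> pq; apply: contra nOp; apply: clO.
      by rewrite forces_swap.
    apply/forall_inP=> q; rewrite !inE negb_or => /orP[Oq|pq].
      rewrite (asymO _ Oq); apply/negP=> /disj.
      by rewrite arc_swapK Oq.
    rewrite disj //; apply: contra np => pq'.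
    by apply: forces_trans pq' _; rewrite forces_swap.
  - apply/forall_inP=> q Fq; apply/forallP=> r; apply/implyP=> qr.
    move: Fq; rewrite !inE => /orP[/(clO _ _ qr)->//|pq].
    by rewrite (forces_trans pq qr) orbT.
exists O; apply/ATTO_P; split; last first.
  move=> p q pq; apply: clO; have /andP[Ep Eq] := aug_arc_AP pq.
  by rewrite /forces Ep Eq connect1.
apply/orientationP; split=> x y; first by move/OAP; rewrite inE.
move=> Exy; apply/idP/idP => [Oxy|nOyx]; first exact: (asymO _ Oxy).
apply/negPn/negP=> nOxy.
have Pxy : (x, y) \in AP G by rewrite inE.
(* On an unoriented edge, maximality makes each arc force the other; both are then necessary. *)
have [f1|nf1] := boolP (forces G (x, y) (y, x)); last first.
  by case/negP: nOxy; apply: extend.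
have [f2|nf2] := boolP (forces G (y, x) (x, y)); last first.
  by case/negP: nOyx; apply: extend => //; rewrite inE adj_sym.
have xyN : (x, y) \in Ness G by rewrite inE.
by have := acyclic_Ness_swap acyN xyN; rewrite inE f1.
Qed.

End AugmentedImplications.

Lemma acyclic_digraphS (V : finType) (A B : {set V * V}) :
  A \subset B -> acyclic_digraph B -> acyclic_digraph A.
Proof.
move/subsetP=> sAB acyB s s_n0 /andP[cyc_s uniq_s]; apply: (acyB s s_n0).
by rewrite /ucycle uniq_s (sub_cycle _ cyc_s) // => x y /=; apply: sAB.
Qed.

Theorem theorem2 (V : finType) (G : temporal_graph V) :
  ((exists O : {set V * V}, TTO G O) <-> (exists O : {set V * V}, ATTO G O)) /\
  ((exists O : {set V * V}, ATTO G O) <-> acyclic_digraph (Ness G)).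
Proof.
split; split=> [[O tO]|].
- by exists O; apply: TTO_ATTO.
- by case=> O; apply: ATTO_TTO.
(* An ATTO may contain directed triangles, so acyclicity is taken from a TTO, which is itself an
   ATTO and so contains [Ness G]. *)
- have [O' ttoO'] := ATTO_TTO tO.
  exact: acyclic_digraphS (Ness_sub_ATTO (TTO_ATTO ttoO')) (TTO_acyclic ttoO').
- exact: acyclic_Ness_ATTO.
Qed.
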